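(* Let $n$ be a positive integer and let $R$ be a nonzero ring. Then $MC_n(R)$ does not satisfy the ascending chain condition on left direct summands, i.e. on left ideals that are direct summands of $MC_n(R)$ as a left module over itself.
   Context: All rings are associative with $1$. $M_m(R)$ is the ring of $m\times m$ matrices over $R$. Identify $M_n(M_{n^k}(R))$ with $M_{n^{k+1}}(R)$ via block matrices. The $n$-matricial closure $MC_n(R)$ is the direct limit of the rings $M_{n^k}(R)$, $k\in\mathbb{N}=\{0,1,2,\dots\}$ (with $M_{n^0}(R)=R$), along the injective ring morphisms $M_{n^k}(R)\to M_{n^{k+1}}(R)$ sending $A$ to the block diagonal matrix with $n$ diagonal blocks equal to $A$.
   Formalization: The formal theorem assumes n ≥ 2 instead of n a positive integer; for n = 1 one has MC_1(R) = R, and the claim is false, for example, when R is a field. *)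

(* Defs.v *)
From HB Require Import structures.
From mathcomp Require Import all_boot all_algebra boolp.

Set Implicit Arguments.
Unset Strict Implicit.
Unset Printing Implicit Defensive.
Import GRing.Theory.
Local Open Scope ring_scope.
Local Open Scope quotient_scope.

(* Direct limit of a sequence A 0 -> A 1 -> A 2 -> ... of rings, as the       *)
(* quotient of the disjoint union {k & A k} identifying elements that become  *)
(* equal at some later stage.                                                 *)
Section DirectLimit.
Variables (A : nat -> pzRingType) (f : forall k, {rmorphism A k -> A k.+1}).
Local Notation T := {k : nat & A k}.

Definition dl_next (x : T) : T := Tagged A (f (tag x) (tagged x)).

(* An equality between elements of T also equates their stages. *)
Definition dl_rel (x y : T) : bool :=
  `[< exists p q, iter p dl_next x = iter q dl_next y >].

Fact dl_rel_equiv : equiv_class_of dl_rel.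
Proof.
split=> [x | x y | y x z].
- by apply/asboolP; exists 0%N, 0%N.
- by apply/asboolP/asboolP => -[p [q e]]; exists q, p.
move=> /asboolP[p [q e]] /asboolP[p' [q' e']]; apply/asboolP.
exists (p' + p)%N, (q + q')%N.
by rewrite !iterD e -e' -!iterD addnC.
Qed.
Canonical dl_equiv := EquivRelPack dl_rel_equiv.

Definition dirlim : Type := {eq_quot dl_equiv}.
HB.instance Definition _ := EqQuotient.on dirlim.
HB.instance Definition _ := Choice.on dirlim.

Definition dl_inj k (a : A k) : dirlim := \pi_dirlim (Tagged A a).

Fixpoint dl_shift p k : A k -> A (p + k)%N :=
  if p is p'.+1 return A k -> A (p + k)%N
  then fun a => f (p' + k)%N (dl_shift p' a) else id.

(* x and y moved to the common stage tag y + tag x, then combined there. *)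
Definition dl_op2 (op : forall k, A k -> A k -> A k) (x y : T) : T :=
  Tagged A (op _ (dl_shift (tag y) (tagged x))
    (ecast i (A i) (addnC (tag x) (tag y)) (dl_shift (tag x) (tagged y)))).

Definition dl_zero : dirlim := dl_inj (0 : A 0%N).
Definition dl_one : dirlim := dl_inj (1 : A 0%N).
Definition dl_opp (x : dirlim) : dirlim := dl_inj (- tagged (repr x)).
Definition dl_add (x y : dirlim) : dirlim :=
  \pi_dirlim (dl_op2 (fun k => +%R) (repr x) (repr y)).
Definition dl_mul (x y : dirlim) : dirlim :=
  \pi_dirlim (dl_op2 (fun k => *%R) (repr x) (repr y)).

Lemma iter_dl_next p k (a : A k) :
  iter p dl_next (Tagged A a) = Tagged A (dl_shift p a).
Proof. by elim: p => //= p ->. Qed.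

Lemma dl_shiftD r p k (a : A k) :
  Tagged A (dl_shift (r + p) a) = iter r dl_next (Tagged A (dl_shift p a)).
Proof. by rewrite -[LHS]iter_dl_next iterD iter_dl_next. Qed.

Lemma dl_inj_eqP k l (a : A k) (b : A l) :
  dl_inj a = dl_inj b <->
  exists p q, Tagged A (dl_shift p a) = Tagged A (dl_shift q b).
Proof.
split=> [/eqmodP /asboolP [p [q e]] | [p [q e]]]; last first.
  by apply/eqmodP/asboolP; exists p, q; rewrite !iter_dl_next.
by exists p, q; rewrite -!iter_dl_next.
Qed.

Lemma dl_inj_shift p k (a : A k) : dl_inj (dl_shift p a) = dl_inj a.
Proof.
apply/eqmodP/asboolP; exists 0%N, p.
by rewrite !iter_dl_next.
Qed.

Lemma dl_inj_next k (a : A k) : dl_inj (f k a) = dl_inj a.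
Proof. exact: (@dl_inj_shift 1). Qed.

Lemma dl_inj_cast i j (e : i = j) (a : A i) :
  dl_inj (ecast i (A i) e a) = dl_inj a.
Proof. by case: _ / e. Qed.

Lemma dl_inj_repr (x : dirlim) : dl_inj (tagged (repr x)) = x.
Proof. by rewrite /dl_inj taggedK reprK. Qed.

Lemma dl_inj_ex (x : dirlim) : exists k (a : A k), x = dl_inj a.
Proof. by exists (tag (repr x)), (tagged (repr x)); rewrite dl_inj_repr. Qed.

Lemma dl_inj_ex2 (x y : dirlim) :
  exists k (a b : A k), x = dl_inj a /\ y = dl_inj b.
Proof.
have [k [a ->]] := dl_inj_ex x; have [l [b ->]] := dl_inj_ex y.
exists (l + k)%N, (dl_shift l a), (ecast i (A i) (addnC k l) (dl_shift k b)).
by rewrite dl_inj_cast !dl_inj_shift.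
Qed.

Lemma dl_inj_ex3 (x y z : dirlim) : exists k (a b c : A k),
  [/\ x = dl_inj a, y = dl_inj b & z = dl_inj c].
Proof.
have [k [a [b [-> ->]]]] := dl_inj_ex2 x y; have [l [c ->]] := dl_inj_ex z.
exists (l + k)%N, (dl_shift l a), (dl_shift l b).
exists (ecast i (A i) (addnC k l) (dl_shift k c)).
by rewrite dl_inj_cast !dl_inj_shift.
Qed.

Section Op2.
Variable op : forall k, A k -> A k -> A k.
Hypothesis fop : forall k (a b : A k), f k (op a b) = op (f k a) (f k b).

Lemma dl_shift_op p k (a b : A k) :
  dl_shift p (op a b) = op (dl_shift p a) (dl_shift p b).
Proof. by elim: p => //= p ->; rewrite fop. Qed.

Lemma dl_inj_op i j (a b : A i) (c d : A j) :
  dl_inj a = dl_inj c -> dl_inj b = dl_inj d ->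
  dl_inj (op a b) = dl_inj (op c d).
Proof.
move=> /dl_inj_eqP[p [q e]] /dl_inj_eqP[r [s e']].
have epq : (p + i = q + j)%N by apply: (congr1 tag e).
have ers : (r + i = s + j)%N by apply: (congr1 tag e').
have E1 : Tagged A (dl_shift (r + p) a) = Tagged A (dl_shift (r + q) c).
  by rewrite !dl_shiftD e.
have E2 : Tagged A (dl_shift (r + p) b) = Tagged A (dl_shift (r + q) d).
  have rqE : (r + q)%N = (p + s)%N.
    by apply/eqP; rewrite -(eqn_add2r j) -!addnA -ers -epq addnCA.
  by rewrite -!iter_dl_next (addnC r) rqE !iterD (iter_dl_next r) e' (iter_dl_next s).
rewrite -(dl_inj_shift (r + p) (op a b)) -(dl_inj_shift (r + q) (op c d)).
rewrite !dl_shift_op.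
have es : (r + p + i = r + q + j)%N by rewrite -!addnA epq.
move: (dl_shift _ a) (dl_shift _ b) (dl_shift _ c) (dl_shift _ d) E1 E2.
case: _ / es => a' b' c' d' E1 E2.
by rewrite (eq_from_Tagged E1) (eq_from_Tagged E2).
Qed.

Lemma dl_op2E k (a b : A k) :
  \pi_dirlim (dl_op2 op (repr (dl_inj a)) (repr (dl_inj b))) = dl_inj (op a b).
Proof.
apply: dl_inj_op; first by rewrite dl_inj_shift dl_inj_repr.
by rewrite dl_inj_cast dl_inj_shift dl_inj_repr.
Qed.
End Op2.

Lemma dl_addE k (a b : A k) : dl_add (dl_inj a) (dl_inj b) = dl_inj (a + b).
Proof. by apply: (dl_op2E (op := fun k => +%R)) => l c d; rewrite rmorphD. Qed.

Lemma dl_mulE k (a b : A k) : dl_mul (dl_inj a) (dl_inj b) = dl_inj (a * b).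
Proof. by apply: (dl_op2E (op := fun k => *%R)) => l c d; rewrite rmorphM. Qed.

Lemma dl_oppE k (a : A k) : dl_opp (dl_inj a) = dl_inj (- a).
Proof.
pose op k (x _ : A k) := - x.
apply: (@dl_inj_op op _ _ _ _ (tagged _) a a); last 2 first.
- exact: dl_inj_repr.
- exact: dl_inj_repr.
by move=> l c d; rewrite /op rmorphN.
Qed.

Lemma dl_zeroE k : dl_zero = dl_inj (0 : A k).
Proof.
by elim: k => // k ->; rewrite -dl_inj_next rmorph0.
Qed.

Lemma dl_oneE k : dl_one = dl_inj (1 : A k).
Proof.
by elim: k => // k ->; rewrite -dl_inj_next rmorph1.
Qed.

Fact dl_addA : associative dl_add.
Proof.
move=> x y z; have [k [a [b [c [-> -> ->]]]]] := dl_inj_ex3 x y z.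
by rewrite !dl_addE addrA.
Qed.

Fact dl_addC : commutative dl_add.
Proof.
move=> x y; have [k [a [b [-> ->]]]] := dl_inj_ex2 x y.
by rewrite !dl_addE addrC.
Qed.

Fact dl_add0 : left_id dl_zero dl_add.
Proof.
by move=> x; have [k [a ->]] := dl_inj_ex x; rewrite (dl_zeroE k) dl_addE add0r.
Qed.

Fact dl_addN : left_inverse dl_zero dl_opp dl_add.
Proof.
move=> x; have [k [a ->]] := dl_inj_ex x.
by rewrite (dl_zeroE k) dl_oppE dl_addE addNr.
Qed.

HB.instance Definition _ :=
  GRing.isZmodule.Build dirlim dl_addA dl_addC dl_add0 dl_addN.

Fact dl_mulA : associative dl_mul.
Proof.
move=> x y z; have [k [a [b [c [-> -> ->]]]]] := dl_inj_ex3 x y z.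
by rewrite !dl_mulE mulrA.
Qed.

Fact dl_mul1 : left_id dl_one dl_mul.
Proof.
by move=> x; have [k [a ->]] := dl_inj_ex x; rewrite (dl_oneE k) dl_mulE mul1r.
Qed.

Fact dl_mulr1 : right_id dl_one dl_mul.
Proof.
by move=> x; have [k [a ->]] := dl_inj_ex x; rewrite (dl_oneE k) dl_mulE mulr1.
Qed.

Fact dl_mulDl : left_distributive dl_mul +%R.
Proof.
move=> x y z; have [k [a [b [c [-> -> ->]]]]] := dl_inj_ex3 x y z.
by rewrite ![_ + _]dl_addE !dl_mulE [RHS]dl_addE mulrDl.
Qed.

Fact dl_mulDr : right_distributive dl_mul +%R.
Proof.
move=> x y z; have [k [a [b [c [-> -> ->]]]]] := dl_inj_ex3 x y z.
by rewrite ![_ + _]dl_addE !dl_mulE [RHS]dl_addE mulrDr.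
Qed.

HB.instance Definition _ := GRing.Zmodule_isPzRing.Build dirlim
  dl_mulA dl_mul1 dl_mulr1 dl_mulDl dl_mulDr.

Fact dl_inj_zmod k : zmod_morphism (@dl_inj k).
Proof.
move=> a b; rewrite -[- dl_inj b]/(dl_opp _) dl_oppE.
by rewrite -[RHS]/(dl_add _ _) dl_addE.
Qed.
HB.instance Definition _ k :=
  GRing.isZmodMorphism.Build (A k) dirlim (@dl_inj k) (@dl_inj_zmod k).

Fact dl_inj_monoid k : monoid_morphism (@dl_inj k).
Proof.
by split=> [|a b]; [rewrite -dl_oneE | rewrite -dl_mulE].
Qed.
HB.instance Definition _ k :=
  GRing.isMonoidMorphism.Build (A k) dirlim (@dl_inj k) (@dl_inj_monoid k).

End DirectLimit.

Section MatricialClosure.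
Variables (n : nat) (R : nzRingType).

Fact bdiag_size k : (\sum_(i < n) n ^ k = n ^ k.+1)%N.
Proof. by rewrite sum_nat_const card_ord expnS. Qed.

Definition bdiag k (M : 'M[R]_(n ^ k)) : 'M[R]_(n ^ k.+1) :=
  castmx (bdiag_size k, bdiag_size k) (\mxdiag_(i < n) M).

Fact bdiag_zmod k : zmod_morphism (@bdiag k).
Proof.
rewrite /bdiag; case: _ / (bdiag_size k) => M N.
by rewrite !castmx_id mxdiagB.
Qed.
HB.instance Definition _ k := GRing.isZmodMorphism.Build
  'M[R]_(n ^ k) 'M[R]_(n ^ k.+1) (@bdiag k) (@bdiag_zmod k).

Fact bdiag_monoid k : monoid_morphism (@bdiag k).
Proof.
rewrite /bdiag; case: _ / (bdiag_size k).
split=> [|M N]; rewrite !castmx_id; first exact: mxdiagZ.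
rewrite -[RHS]/(_ *m _) {2}/mxdiag mul_mxdiag_mxblock; apply/eq_mxblock => i j.
case: eqVneq => [e|_]; first by case: _ / e; rewrite !conform_mx_id.
by rewrite mulmx0.
Qed.
HB.instance Definition _ k := GRing.isMonoidMorphism.Build
  'M[R]_(n ^ k) 'M[R]_(n ^ k.+1) (@bdiag k) (@bdiag_monoid k).

Definition bdiag_morph k : {rmorphism 'M[R]_(n ^ k) -> 'M[R]_(n ^ k.+1)} :=
  @bdiag k.

Definition MC : pzRingType := dirlim bdiag_morph.

Definition MC_inj k : {rmorphism 'M[R]_(n ^ k) -> MC} :=
  (@dl_inj _ bdiag_morph k : {rmorphism _ -> dirlim bdiag_morph}).

End MatricialClosure.

(* Classically every subset is a boolean predicate. *)
Definition direct_summand (S : pzRingType) (V : lmodType S) (I : {pred V}) :=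
  submod_closed I /\
  exists J : {pred V}, [/\ submod_closed J,
    forall v, exists2 a, a \in I & exists2 b, b \in J & v = a + b
    & forall v, v \in I -> v \in J -> v = 0].

(* Left ideals of S are the submodules of S^o, S acting on the left. *)
Definition acc_left_direct_summands (S : pzRingType) :=
  forall I : nat -> {pred S^o},
    (forall k, direct_summand (I k)) ->
    (forall k, {subset I k <= I k.+1}) ->
    exists N, forall k, (N <= k)%N -> I k =i I N.

(* Main.v *)
Require Import Defs.
From mathcomp Require Import all_boot all_algebra.

(* Left annihilators of a strictly descending sequence of idempotents form a  *)
(* strictly ascending sequence of left direct summands. In MC n R such a      *)
(* sequence is given by the matrix units f_k = E_00 of the rings M_(n^k)(R):  *)
(* f_k becomes diag(f_k, f_k, ..., f_k) at stage k + 1, whereas               *)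
(* f_(k+1) = diag(f_k, 0, ..., 0), and these differ because n > 1.            *)

Set Implicit Arguments.
Unset Strict Implicit.
Unset Printing Implicit Defensive.
Import GRing.Theory.
Local Open Scope ring_scope.

(** [descending_idempotents_not_acc] is the ring-theoretic criterion. [bdiag_cornerM] and
    [corner_bdiagM_neq] verify it one stage at a time, and [dl_inj_injective] carries the inequality
    to the limit. The bound [1 < n] matters: for n = 1 the closure is R itself, possibly a field. *)

Definition lann (S : pzRingType) (f : S) : {pred S^o} :=
  [pred v : S^o | (v : S) * f == 0].

Lemma lann_submod (S : pzRingType) (f : S) : submod_closed (lann f).
Proof.
split=> [|a u v]; rewrite !inE ?mul0r // => /eqP uf0 /eqP vf0.
by rewrite mulrDl vf0 addr0 -[a *: u]/((a : S) * (u : S)) -mulrA uf0 mulr0.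
Qed.

(** Peirce decomposition: v = v(1 - f) + vf, with complement the annihilator of 1 - f. *)
Lemma lann_direct_summand (S : pzRingType) (f : S) :
  f * f = f -> direct_summand (lann f).
Proof.
move=> ff; split; first exact: lann_submod.
exists (lann (1 - f)); split=> [|v|v]; first exact: lann_submod.
  exists ((v : S) * (1 - f)).
    by rewrite inE -mulrA mulrBl mul1r ff subrr mulr0.
  exists ((v : S) * f).
    by rewrite inE -mulrA mulrBr mulr1 ff subrr mulr0.
  by rewrite mulrBr mulr1 subrK.
by rewrite !inE mulrBr mulr1 => /eqP -> /eqP; rewrite subr0.
Qed.

Lemma descending_idempotents_not_acc (S : pzRingType) (f : nat -> S) :
    (forall k, f k * f k = f k) -> (forall k, f k * f k.+1 = f k.+1) ->
    (forall k, f k.+1 * f k <> f k) ->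
  ~ acc_left_direct_summands S.
Proof.
move=> ff fS fneq /(_ (fun k => lann (f k))) [k||N stab].
- exact: lann_direct_summand.
- by move=> k v; rewrite !inE => /eqP vf0; rewrite -fS mulrA vf0 mul0r.
(* 1 - f_(N+1) kills f_(N+1); were it to kill f_N too, then f_(N+1) f_N = f_N. *)
have /esym := stab N.+1 (leqnSn N) (1 - f N.+1).
rewrite !inE !mulrBl !mul1r ff subrr eqxx subr_eq0 => /eqP e.
exact: (fneq N (esym e)).
Qed.

Lemma dl_inj_injective (A : nat -> pzRingType)
    (f : forall k, {rmorphism A k -> A k.+1}) k :
  (forall i, injective (f i)) -> injective (@dl_inj A f k).
Proof.
move=> f_inj.
have shift_inj p : injective (@dl_shift A f p k).
  by elim: p => // p IHp a b /f_inj /IHp.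
move=> a b /dl_inj_eqP[p [q e]].
(* Equal tagged elements lie at the same stage, so p = q. *)
have /eqP : (p + k = q + k)%N by apply: (congr1 tag e).
rewrite eqn_add2r => /eqP epq; rewrite -{q}epq in e.
exact: (shift_inj p _ _ (eq_from_Tagged e)).
Qed.

Section BlockDiagonal.
Variables (n : nat) (R : nzRingType) (k : nat).
Implicit Types B C : 'I_n -> 'M[R]_(n ^ k).

(** [bdiag M] is, by conversion, the case of a constant family. *)
Definition blockdiag B : 'M[R]_(n ^ k.+1) :=
  castmx (bdiag_size n k, bdiag_size n k) (\mxdiag_(i < n) B i).

Lemma blockdiagM B C :
  blockdiag B * blockdiag C = blockdiag (fun i => B i * C i).
Proof.
rewrite /blockdiag; case: _ / (bdiag_size n k); rewrite !castmx_id.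
rewrite -[LHS]/(_ *m _) {2}/mxdiag mul_mxdiag_mxblock.
apply/eq_mxblock => i j.
case: eqVneq => [e|_]; first by case: _ / e; rewrite !conform_mx_id.
by rewrite mulmx0.
Qed.

Lemma eq_blockdiag B C : B =1 C -> blockdiag B = blockdiag C.
Proof. by move=> eBC; congr castmx; apply/eq_mxdiag => i. Qed.

Lemma blockdiag_inj B C : blockdiag B = blockdiag C -> B =1 C.
Proof.
rewrite /blockdiag; case: _ / (bdiag_size n k); rewrite !castmx_id.
by move/eq_mxdiagP.
Qed.

End BlockDiagonal.

Lemma bdiag_inj (n : nat) (R : nzRingType) k :
  (0 < n)%N -> injective (@bdiag n R k).
Proof.
by move=> n_gt0 M N /(@blockdiag_inj n R k (fun=> M) (fun=> N)) /(_ (Ordinal n_gt0)).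
Qed.

Section CornerUnit.
Variables (n : nat) (R : nzRingType).

(** The matrix unit E_00 in recursive block form, so that products reduce to blocks. *)
Fixpoint corner k : 'M[R]_(n ^ k) :=
  if k is k'.+1 return 'M[R]_(n ^ k)
  then blockdiag (fun i : 'I_n => if val i == 0%N then corner k' else 0) else 1.

Lemma corner_idem k : corner k * corner k = corner k.
Proof.
elim: k => [|k IHk]; first exact: mulr1.
rewrite /= blockdiagM; apply: eq_blockdiag => i.
by case: ifP => _; [exact: IHk | exact: mulr0].
Qed.

Lemma corner_neq0 k : (0 < n)%N -> corner k <> 0.
Proof.
move=> n_gt0; elim: k => [|k IHk]; first exact/eqP/(oner_neq0 'M[R]_1).
(* Zero is rewritten as a block diagonal matrix, to compare the blocks of index 0. *)
rewrite -(rmorph0 (bdiag_morph n R k)).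
by move/(@blockdiag_inj n R k _ (fun=> 0))/(_ (Ordinal n_gt0)).
Qed.

Lemma bdiag_cornerM k : bdiag (corner k) * corner k.+1 = corner k.+1.
Proof.
rewrite [LHS](blockdiagM (fun=> corner k)); apply: eq_blockdiag => i.
by case: ifP => _; [exact: corner_idem | exact: mulr0].
Qed.

Lemma corner_bdiagM_neq k :
  (1 < n)%N -> corner k.+1 * bdiag (corner k) <> bdiag (corner k).
Proof.
move=> n_gt1; rewrite [X in X <> _](blockdiagM _ (fun=> corner k)).
(* The blocks of index 1 are 0 on the left and [corner k] on the right. *)
move/(@blockdiag_inj n R k _ (fun=> corner k))/(_ (Ordinal n_gt1)) => /=.
by rewrite mul0r => /esym; apply: corner_neq0; apply: ltnW.
Qed.

End CornerUnit.

Theorem corollary11 (n : nat) (R : nzRingType) (hn : (1 < n)%N) :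
  ~ acc_left_direct_summands (MC n R).
Proof.
have nextE k (a : 'M[R]_(n ^ k)) : MC_inj n R k a = MC_inj n R k.+1 (bdiag a).
  exact/esym/(@dl_inj_next _ (bdiag_morph n R)).
apply: (@descending_idempotents_not_acc _ (fun k => MC_inj n R k (corner n R k))).
- by move=> k; rewrite -rmorphM corner_idem.
- by move=> k; rewrite nextE -rmorphM bdiag_cornerM.
(* Both idempotents are compared at stage k + 1. *)
move=> k; rewrite (nextE k) -rmorphM.
move/(@dl_inj_injective _ (bdiag_morph n R) k.+1
  (fun i => @bdiag_inj n R i (ltnW hn))).
exact: corner_bdiagM_neq.
Qed.
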